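(* Let $\mathcal{L}$ be a nonempty class (set) of $d$-dimensional closed convex sets in $\mathbb{R}^d$ such that for every $L\in\mathcal{L}$ the set $\operatorname{rec}(L)$ is a linear space. Let $$M:=\mathbb{R}^d\setminus\bigcup_{L\in\mathcal{L}}\operatorname{int}(L).$$ Then the following statements hold. I. For every line-free closed convex set $K$ in $\mathbb{R}^d$ one has $$\bigcap_{i=0}^{+\infty}R_{\mathcal{L}}^i(K)=\operatorname{conv}(K\cap M)+\operatorname{rec}(K).$$ II. If $M$ is a mixed-integer space (that is, $M=\mathbb{Z}^m\times\mathbb{R}^n$ for some integers $m\ge1$ and $n\ge0$ with $m+n=d$), then for every line-free rational polyhedron $P$ in $\mathbb{R}^d$ one has $$\bigcap_{i=0}^{+\infty}R_{\mathcal{L}}^i(P)=\operatorname{conv}(P\cap M).$$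
   Context: Here $d\in\mathbb{N}=\{1,2,\ldots\}$. For a closed convex set $K\subseteq\mathbb{R}^d$ and a $d$-dimensional closed convex set $L$, $R_L(K):=\operatorname{conv}(K\setminus\operatorname{int}(L))$; $R_{\mathcal{L}}(K):=\bigcap_{L\in\mathcal{L}}R_L(K)$; $R_{\mathcal{L}}^0(K):=K$ and $R_{\mathcal{L}}^i(K):=R_{\mathcal{L}}(R_{\mathcal{L}}^{i-1}(K))$ for $i\in\mathbb{N}$. A closed convex set is line-free if it contains no line. The recession cone of a nonempty closed convex set $K$ is $\operatorname{rec}(K)=\{y\in\mathbb{R}^d : x+ty\in K\ \forall x\in K\ \forall t\ge0\}$. The sum is the Minkowski sum (so the sum of the empty set with any set is empty). A rational polyhedron is a set $\{x\in\mathbb{R}^d:\langle x,a_i\rangle\le\alpha_i,\ i=1,\ldots,n\}$ with $n\ge 0$, $a_i\in\mathbb{Q}^d\setminus\{o\}$, $\alpha_i\in\mathbb{Q}$, where $o$ is the origin (possibly empty or unbounded). *)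

(* Defs.v *)
From HB Require Import structures.
From mathcomp Require Import all_boot all_order all_algebra.
From mathcomp Require Import all_classical all_reals all_analysis.

Set Implicit Arguments.
Unset Strict Implicit.
Unset Printing Implicit Defensive.

Import Order.TTheory GRing.Theory Num.Theory.
Import numFieldNormedType.Exports.

Local Open Scope classical_set_scope.
Local Open Scope ring_scope.

Section ConvexGeometry.
Variables (R : realType) (d : nat).
Implicit Types (A B K L M P : set 'rV[R]_d) (LL : set (set 'rV[R]_d)).

Definition is_convex A : Prop := @convex_set R 'rV[R]_d A.

Definition closed_convex A : Prop := closed A /\ is_convex A.

Definition convex_hull A : set 'rV[R]_d := smallest is_convex A.

Definition is_affine A : Prop :=
  forall (x y : 'rV[R]_d) (t : R), A x -> A y -> A ((1 - t) *: x + t *: y).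

Definition affine_hull A : set 'rV[R]_d := smallest is_affine A.

(* The dimension of a set is that of the direction space of its affine hull;
   the empty set has no dimension here (its affine hull is empty). *)
Definition has_dim A (k : nat) : Prop :=
  exists (x : 'rV[R]_d) (U : {vspace 'rV[R]_d}),
    affine_hull A = [set x + u | u in [set` U]] /\ \dim U = k.

Definition is_linear_space A : Prop :=
  exists U : {vspace 'rV[R]_d}, A = [set` U].

Definition minkowski_sum A B : set 'rV[R]_d := [set x + y | x in A & y in B].

(* Meaningful for nonempty [K] only: [rec_cone set0] is the whole space. *)
Definition rec_cone K : set 'rV[R]_d :=
  [set y | forall x, K x -> forall t : R, 0 <= t -> K (x + t *: y)].

Definition line_free K : Prop :=
  ~ exists x v : 'rV[R]_d, v != 0 /\ forall t : R, K (x + t *: v).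

Definition inner (x y : 'rV[R]_d) : R := \sum_(j < d) x ord0 j * y ord0 j.

Definition rational_polyhedron P : Prop :=
  exists (n : nat) (a : 'I_n -> 'rV[rat]_d) (alpha : 'I_n -> rat),
    (forall i, a i != 0) /\
    P = [set x : 'rV[R]_d | forall i, inner x (map_mx ratr (a i)) <= ratr (alpha i)].

Definition R_set L K : set 'rV[R]_d := convex_hull (K `\` interior L).

Definition R_closure LL K : set 'rV[R]_d := \bigcap_(L in LL) R_set L K.

Definition R_iter LL (i : nat) K : set 'rV[R]_d := iter i (R_closure LL) K.

(* Z^m x R^n inside R^d, d = m + n: the first [m] coordinates are integers. *)
Definition mixed_integer_space M : Prop :=
  exists m n : nat, [/\ (1 <= m)%N, (m + n)%N = d &
    M = [set x : 'rV[R]_d | forall j : 'I_d, (j < m)%N -> x ord0 j \is a Num.int]].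

Definition uncovered LL : set 'rV[R]_d := ~` (\bigcup_(L in LL) interior L).

End ConvexGeometry.

(* Main.v *)
Require Import Defs.
From HB Require Import structures.
From mathcomp Require Import all_boot all_order all_algebra.
From mathcomp Require Import all_classical all_reals all_analysis.
From mathcomp Require Import lra ring.

Set Implicit Arguments.
Unset Strict Implicit.
Unset Printing Implicit Defensive.

Import Order.TTheory GRing.Theory Num.Theory.
Import numFieldNormedType.Exports.

Local Open Scope classical_set_scope.
Local Open Scope ring_scope.

(** The proof homogenizes. A point [x] of R^d is identified with the point
    (1, x) of R^(1 + d), a closed convex set [K] with the closed cone
    [cone_over K], whose elements at height 0 are the recession directions of
    [K], and the interior of [L] with the open cone [open_cone_over L]. If [K]
    is nonempty and line-free then [cone_over K] is pointed, which restores the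
    compactness that [K] itself may lack: some linear functional dominates a
    positive multiple of the norm on the whole cone
    ([pointed_cone_functional]).

    Removing the interior of [L] and taking the convex hull becomes removing
    [open_cone_over L] and taking all finite sums ([slice_cone_hullD]). This is
    where linearity of [rec_cone L] is used: the finite sums also add recession
    directions of [K], and this does not enlarge the hull, because a ray that
    starts outside the interior of [L] and enters it must leave [L] again
    ([ray_leaves]).

    For cones the result is [bigcap_cone_step]. Let [Koo] be the intersection
    of the iterates. By Caratheodory's theorem ([caratheodory]) a bounded
    number of summands suffices, so by compactness finite sums commute with
    decreasing intersections ([bigcap_cone_hull]), and for each removed open
    cone O every element of [Koo] is a sum of elements of [Koo] outside O. An
    extreme ray of [Koo] is then outside every O. Were some element of [Koo]
    not a sum of elements outside all the removed cones, a separating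
    functional would be positive at it, hence on some extreme ray of [Koo]
    ([extreme_ray]), a contradiction. Cutting at height 1 turns this into the
    first claim ([bigcap_R_iter]), the summands of height 0 giving [rec_cone K].

    For the second claim, the recession cone of a nonempty rational polyhedron
    is the convex hull of its rational vectors ([rational_cone_ind]). These have
    positive integral multiples ([common_denominator]), so adding recession
    directions to the convex hull of the mixed-integer points does not enlarge
    it ([convex_hull_add_rec]). *)

Lemma sum_continuous (R : realType) (T : topologicalType) (I : Type) (s : seq I)
    (f : I -> T -> R) :
  (forall i, continuous (f i)) -> continuous (fun x => \sum_(i <- s) f i x).
Proof.
move=> cf x; elim: s => [|i s IHs].
  by under eq_fun do rewrite big_nil; exact: cvg_cst.
under eq_fun do rewrite big_cons.
by apply: cvgD; [exact: cf|exact: IHs].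
Qed.

(** * The dot product on row vectors *)

Section Inner.
Variables (R : realType) (d : nat).
Implicit Types (x y z : 'rV[R]_d) (t : R).

Lemma innerC x y : inner x y = inner y x.
Proof. by apply: eq_bigr => j _; rewrite mulrC. Qed.

Lemma innerDr x y z : inner x (y + z) = inner x y + inner x z.
Proof. by rewrite -big_split; apply: eq_bigr => j _; rewrite mxE mulrDr. Qed.

Lemma innerZr t x y : inner x (t *: y) = t * inner x y.
Proof. by rewrite mulr_sumr; apply: eq_bigr => j _; rewrite mxE mulrCA. Qed.

Lemma innerDl x y z : inner (x + y) z = inner x z + inner y z.
Proof. by rewrite !(innerC _ z) innerDr. Qed.

Lemma innerZl t x y : inner (t *: x) y = t * inner x y.
Proof. by rewrite !(innerC _ y) innerZr. Qed.

Lemma innerNr x y : inner x (- y) = - inner x y.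
Proof. by rewrite -scaleN1r innerZr mulN1r. Qed.

Lemma innerNl x y : inner (- x) y = - inner x y.
Proof. by rewrite innerC innerNr innerC. Qed.

Lemma inner0r x : inner x 0 = 0.
Proof. by rewrite -(scale0r 0) innerZr mul0r. Qed.

Lemma inner0l x : inner 0 x = 0.
Proof. by rewrite innerC inner0r. Qed.

Lemma inner_ge0 x : 0 <= inner x x.
Proof. by apply: sumr_ge0 => j _; rewrite -expr2 sqr_ge0. Qed.

Lemma inner_delta j x : inner (delta_mx ord0 j) x = x ord0 j.
Proof.
rewrite /inner (bigD1 j)//= mxE !eqxx mul1r big1 ?addr0// => i ij.
by rewrite mxE (negbTE ij) mul0r.
Qed.

Lemma inner_suml (I : eqType) (s : seq I) (F : I -> 'rV[R]_d) x :
  inner (\sum_(i <- s) F i) x = \sum_(i <- s) inner (F i) x.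
Proof.
elim: s => [|i s IHs]; first by rewrite !big_nil inner0l.
by rewrite !big_cons innerDl IHs.
Qed.

Lemma sqr_coord_le_inner x j : x ord0 j ^+ 2 <= inner x x.
Proof.
rewrite /inner (bigD1 j)//= -expr2 lerDl.
by apply: sumr_ge0 => i _; rewrite -expr2 sqr_ge0.
Qed.

Lemma inner_eq0 x : inner x x = 0 -> x = 0.
Proof.
move=> x0; apply/rowP => j; rewrite mxE; apply/eqP.
by rewrite -sqrf_eq0 eq_le sqr_ge0 -x0 sqr_coord_le_inner.
Qed.

Lemma inner_gt0 x : x != 0 -> 0 < inner x x.
Proof.
by move=> x0; rewrite lt_def inner_ge0 andbT; apply: contra x0 => /eqP/inner_eq0->.
Qed.

Lemma inner_continuous x : continuous (inner x).
Proof.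
apply: (@sum_continuous R _ _ _ (fun j z => x ord0 j * z ord0 j)) => j y.
apply: (@continuousM R _ (fun=> x ord0 j) (fun z : 'rV[R]_d => z ord0 j)).
- exact: cst_continuous.
- exact: coord_continuous.
Qed.

Lemma dist2_continuous y : continuous (fun x => inner (x - y) (x - y)).
Proof.
apply: (@sum_continuous R _ _ _
  (fun j z => (z - y) ord0 j * (z - y) ord0 j)) => j x.
have c : {for x, continuous (fun z : 'rV[R]_d => (z - y) ord0 j)}.
  rewrite (_ : (fun z : 'rV[R]_d => _) = (fun z => z ord0 j - y ord0 j)).
    apply: (@continuousB R R _ (fun z : 'rV[R]_d => z ord0 j) (fun=> y ord0 j)).
      exact: coord_continuous.
    exact: cst_continuous.
  by apply/funext => z; rewrite !mxE.
exact: continuousM.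
Qed.

Lemma norm_row_le x (M : R) : 0 <= M -> (forall j, `|x ord0 j| <= M) -> `|x| <= M.
Proof.
move=> M0 xM; rewrite [leLHS]/Num.Def.normr /= mx_normrE; apply/bigmax_leP; split=> //=.
by move=> [i j] _ /=; rewrite (ord1 i).
Qed.

Lemma bounded_closed_compact_row (A : set 'rV[R]_d) (M : R) :
  (forall x, A x -> `|x| <= M) -> closed A -> compact A.
Proof.
move=> AM cA; apply: bounded_closed_compact => //.
exists M; split; first exact: num_real.
by move=> N /ltW MN x /AM /le_trans; apply.
Qed.
End Inner.

(** * Separation for closed convex cones *)

Section Cones.
Variables (R : realType) (d : nat).
Local Notation V := 'rV[R]_d.
Implicit Types (x y z w f : V) (t : R) (A B C : set V).

Definition is_cone A := A 0 /\ forall x t, 0 <= t -> A x -> A (t *: x).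

Definition convex_cone A :=
  is_cone A /\ forall x y, A x -> A y -> A (x + y).

Definition pointed A := forall x, A x -> A (- x) -> x = 0.

(** The functional is [inner (w - p)] for a point [p] of [C] nearest to [w];
    it exists because the points of [C] at least as close to [w] as the origin
    form a compact set. *)
Lemma cone_separation C w : convex_cone C -> closed C -> ~ C w ->
  exists2 f, 0 < inner f w & forall x, C x -> inner f x <= 0.
Proof.
move=> [[C0 CZ] CD] Ccl nCw.
pose B := C `&` [set x | inner (x - w) (x - w) <= inner w w].
have Bcl : closed B.
  apply: closedI => //; apply: (preimage_closed (D := [set r | r <= inner w w])).
    by move=> x _; exact: dist2_continuous.
  exact: closed_le.
have Bco : compact B.
  apply: (@bounded_closed_compact_row _ _ _ (`|w| + (1 + inner w w))) => // x [_ xB].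
  rewrite -[x](subrK w) addrC (le_trans (ler_normD _ _))// lerD2l.
  apply: norm_row_le => [|j]; first by rewrite addr_ge0// inner_ge0.
  have := le_trans (sqr_coord_le_inner (x - w) j) xB.
  set a := (x - w) ord0 j; have := inner_ge0 w; set b := inner w w => b0 ab.
  by rewrite ler_norml; apply/andP; split; nra.
have [||p] := @compact_EVT_max _ R (fun x => - inner (x - w) (x - w)) B _ Bco.
- by exists 0; split => //=; rewrite sub0r innerNl innerNr opprK.
- apply: continuous_subspaceT => x.
  exact: (@continuousN R R _ _ x (@dist2_continuous R d w x)).
rewrite inE => -[Cp pB] pmax; have [f fE] : exists f, f = w - p by exists (w - p).
(* p is a nearest point of C to w *)
have near x : C x -> inner f f <= inner (x - w) (x - w).
  move=> Cx; have -> : inner f f = inner (p - w) (p - w).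
    by rewrite fE -opprB innerNl innerNr opprK.
  have [xB|/ltW xB] := leP (inner (x - w) (x - w)) (inner w w).
    by rewrite -lerN2; apply: pmax; rewrite inE.
  exact: le_trans pB xB.
have quad x t : C (p + t *: x) -> 2 * t * inner f x <= t ^+ 2 * inner x x.
  move=> /near; rewrite (_ : p + t *: x - w = t *: x - f); last first.
    by rewrite fE opprB [p + _]addrC -addrA.
  rewrite innerDl !innerDr !innerNl !innerNr !innerZr !innerZl.
  rewrite [inner x f]innerC; nra.
have fC x : C x -> inner f x <= 0.
  move=> Cx; rewrite leNgt; apply/negP => fx.
  have x0 := inner_ge0 x.
  pose t := inner f x / (inner x x + 1).
  have t0 : 0 < t by rewrite divr_gt0// ltr_wpDl.
  have := quad x t (CD _ _ Cp (CZ _ _ (ltW t0) Cx)).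
  have -> : inner f x = t * (inner x x + 1) by rewrite divfK// gt_eqF// ltr_wpDl.
  nra.
exists f => //.
have f0 : 0 < inner f f.
  by apply: inner_gt0; rewrite fE subr_eq0; apply: contra_notN nCw => /eqP->.
have fp : 0 <= inner f p.
  rewrite leNgt; apply/negP => fp; have p0 := inner_ge0 p.
  (* moving from p towards the origin stays in C and cannot approach w *)
  pose t := Num.min 1 (- inner f p / (inner p p + 1)).
  have t0 : 0 < t by rewrite lt_min ltr01 divr_gt0// ?oppr_gt0// ltr_wpDl.
  have t1 : t <= 1 by rewrite ge_min lexx.
  have tf : t * (inner p p + 1) <= - inner f p.
    by rewrite -ler_pdivlMr ?ltr_wpDl// ge_min lexx orbT.
  have := quad p (- t); rewrite sqrrN -{1}[p]scale1r -scalerDl => /(_ _).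
  move=> /(_ (CZ _ _ _ Cp)); rewrite subr_ge0 => /(_ t1); nra.
have -> : w = f + p by rewrite fE subrK.
by rewrite innerDr ltr_wpDr.
Qed.

(** The functionals that are nonnegative on [C] form open half-spaces covering
    the unit sphere of [C] (separate [- x] from [C]); by compactness finitely
    many suffice, and their sum is positive on the whole sphere. *)
Lemma pointed_cone_functional C : convex_cone C -> closed C -> pointed C ->
  exists f, exists2 e, 0 < e & forall x, C x -> e * `|x| <= inner f x.
Proof.
move=> Cco Ccl Cpt; have [[C0 CZ] CD] := Cco.
pose S := C `&` [set x | `|x| = 1].
have Scl : closed S.
  apply: closedI => //; apply: (@preimage_closed _ R (fun x : V => `|x|) [set r | r = 1]).
    by move=> x _; exact: norm_continuous.
  exact: closed_eq.
have Sco : compact S.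
  by apply: (@bounded_closed_compact_row _ _ _ 1) => // x [_ ->].
pose D := [set f | forall x, C x -> 0 <= inner f x].
have dual0 : D 0 by move=> x _; rewrite inner0l.
have Scov : cover_compact S by rewrite -compact_cover.
have [|x [Cx x1]|F FD Fcov] := Scov V D (fun f => [set x | 0 < inner f x]).
- move=> f _; apply: (@open_comp _ R (inner f) [set r | 0 < r]); last exact: open_gt.
  by move=> x _; exact: inner_continuous.
- have [|f fx fC] := cone_separation (w := - x) Cco Ccl.
    move=> Cx'; have := Cpt _ Cx Cx' => x0.
    by move: x1; rewrite /= x0 normr0 => /eqP; rewrite eq_sym oner_eq0.
  exists (- f); last by rewrite /= innerNl -innerNr.
  by move=> y /fC; rewrite innerNl oppr_ge0.
pose g := \sum_(f <- finmap.enum_fset F) f.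
have gS x : S x -> 0 < inner g x.
  move=> Sx; have [f Ff fx] := Fcov _ Sx.
  rewrite /g inner_suml (big_rem f)//= ltr_pwDl//.
  rewrite big_seq; apply: sumr_ge0 => h /mem_rem hF.
  by have /FD := hF; rewrite inE; apply; case: Sx.
have [S0|/set0P S0] := eqVneq S set0.
  exists 0, 1 => // x Cx; rewrite inner0l mul1r.
  have [->|x0] := eqVneq x 0; first by rewrite normr0.
  suff: S (`|x|^-1 *: x) by rewrite S0.
  split; first by apply: CZ => //; rewrite invr_ge0.
  by rewrite /= normrZ normfV normr_id mulVf// normr_eq0.
have [|p] := @compact_EVT_max _ R (fun x => - inner g x) S S0 Sco.
  apply: continuous_subspaceT => x.
  exact: (@continuousN R R _ _ x (@inner_continuous R d g x)).
rewrite inE => Sp pmin; exists g, (inner g p); first exact: gS.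
move=> x Cx; have [->|x0] := eqVneq x 0; first by rewrite normr0 mulr0 inner0r.
have nx0 : 0 < `|x| by rewrite normr_gt0.
have : inner g p <= inner g (`|x|^-1 *: x).
  rewrite -lerN2; apply: pmin; rewrite inE.
  split; first by apply: CZ => //; rewrite invr_ge0.
  by rewrite /= normrZ normfV normr_id mulVf// normr_eq0.
by rewrite innerZr [_^-1 * _]mulrC ler_pdivlMr.
Qed.
End Cones.

Lemma nested_compact (T : topologicalType) (K : nat -> set T) :
  (forall i, K i.+1 `<=` K i) -> (forall i, closed (K i)) -> compact (K 0%N) ->
  (forall i, K i !=set0) -> \bigcap_i K i !=set0.
Proof.
move=> Kdec Kcl Kco K0.
have Kle i j : (i <= j)%N -> K j `<=` K i.
  by elim: j => [|j IHj]; [rewrite leqn0 => /eqP->|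
    rewrite leq_eqVlt => /predU1P[->//|/IHj ij x /Kdec/ij]].
have FF : ProperFilter (filter_from setT K).
  apply: filter_from_proper => //; apply: filter_from_filter; first by exists 0%N.
  move=> i j _ _; exists (maxn i j) => // x Kx.
  by split; apply: Kle Kx; rewrite ?leq_maxl ?leq_maxr.
have [x [_ xK]] := Kco _ FF (ex_intro2 _ _ 0%N I (@subset_refl _ _)).
exists x => i _; apply: Kcl => U /(xK (K i)); apply; exists i => //.
Qed.

(** * Finite sums of elements of closed cones *)

Section ConeHull.
Variables (R : realType) (d : nat).
Local Notation V := 'rV[R]_d.
Implicit Types (x y z w f : V) (t : R) (A B C : set V).

Definition sums A n : set V :=
  [set x | exists2 w : 'I_n -> V, (forall i, A (w i)) & x = \sum_i w i].

Definition cone_hull A : set V := \bigcup_n sums A n.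

Lemma sums0 A : sums A 0 = [set 0].
Proof.
apply/seteqP; split => [x [w _ ->]|_ ->]; first by rewrite big_ord0.
by exists (fun=> 0) => [[]//|]; rewrite big_ord0.
Qed.

Lemma sumsS A n : sums A n.+1 = minkowski_sum A (sums A n).
Proof.
apply/seteqP; split => [x [w Aw ->]|_ [a Aa [_ [w Aw ->] <-]]].
  exists (w ord0) => //; exists (\sum_(i < n) w (lift ord0 i)).
    by exists (fun i => w (lift ord0 i)).
  by rewrite big_ord_recl.
exists (fun i => oapp w a (unlift ord0 i)).
  by move=> i; case: unliftP => [j _|_] /=.
rewrite big_ord_recl unlift_none /=; congr (_ + _).
by apply: eq_bigr => i _; rewrite liftK.
Qed.

Lemma sub_cone_hull A : A `<=` cone_hull A.
Proof. by move=> a Aa; exists 1%N => //; exists (fun=> a); rewrite ?big_ord1. Qed.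

Lemma cone_hull_min A B : B 0 -> (forall x y, B x -> B y -> B (x + y)) ->
  A `<=` B -> cone_hull A `<=` B.
Proof.
move=> B0 BD AB x [n _ [w Aw ->]].
by elim/big_ind: _ => // i _; exact: AB.
Qed.

Lemma cone_hullD A x y : cone_hull A x -> cone_hull A y -> cone_hull A (x + y).
Proof.
move=> [n _ + [m _]]; elim: n x => [x|n IHn x].
  by rewrite sums0 => -> my; rewrite add0r; exists m.
rewrite sumsS => -[a Aa [b Ab <-]] ym; rewrite -addrA.
have [k _ ky] := IHn b Ab ym.
by exists k.+1 => //; rewrite sumsS; exists a => //; exists (b + y).
Qed.

Lemma convex_cone_hull A : is_cone A -> convex_cone (cone_hull A).
Proof.
move=> [A0 AZ]; split; last exact: cone_hullD.
split; first exact: sub_cone_hull.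
move=> x t t0 [n _ [w Aw ->]]; exists n => //; exists (fun i => t *: w i).
  by move=> i; exact: AZ.
by rewrite scaler_sumr.
Qed.

Lemma linear_dependence n (w : 'I_n -> V) : (d < n)%N ->
  exists2 c : 'I_n -> R, \sum_i c i *: w i = 0 & exists i, 0 < c i.
Proof.
move=> dn; pose W := \matrix_i w i.
have [i ki] : exists i, row i (kermx W) != 0.
  apply/existsP; rewrite -negb_forall; apply/negP => /forallP k0.
  have : kermx W == 0 by apply/eqP/row_matrixP => i; rewrite row0; apply/eqP/k0.
  by rewrite kermx_eq0 -row_leq_rank leqNgt (leq_ltn_trans (rank_leq_col W) dn).
pose c : 'rV_n := row i (kermx W).
have cW : \sum_j c ord0 j *: w j = 0.
  have : c *m W = 0 by rewrite -row_mul mulmx_ker row0.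
  by rewrite mulmx_sum_row; under eq_bigr do rewrite rowK.
have [j cj] : exists j, c ord0 j != 0.
  apply/existsP; rewrite -negb_forall; apply: contra ki => /forallP c0.
  by apply/eqP/rowP => j; rewrite [RHS]mxE; exact/eqP/c0.
have [cj0|cj0] := ltP 0 (c ord0 j).
  by exists (fun j => c ord0 j) => //; exists j.
exists (fun j => - c ord0 j).
  by under eq_bigr do rewrite scaleNr; rewrite sumrN cW oppr0.
by exists j; rewrite oppr_gt0 lt_def eq_sym cj.
Qed.

(** Caratheodory's theorem for cones: a linear dependence between more than [d]
    summands lets one rescale them until one vanishes. *)
Lemma caratheodory A : is_cone A -> cone_hull A = sums A d.
Proof.
move=> [A0 AZ]; apply/seteqP; split; last by move=> x Ax; exists d.
have up n : sums A n `<=` sums A n.+1.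
  by move=> x nx; rewrite sumsS; exists 0 => //; exists x; rewrite ?add0r.
have down n : (d <= n)%N -> sums A n.+1 `<=` sums A n.
  move=> dn _ [w Aw ->].
  have [c cw [k ck]] := linear_dependence w (leq_ltn_trans dn (ltnSn n)).
  case: (@arg_maxP _ _ _ k xpredT c isT) => i _ imax.
  have {}imax j : c j <= c i by exact: imax.
  have ci : 0 < c i by rewrite (lt_le_trans ck).
  pose v j := (1 - c j / c i) *: w j.
  exists (fun j => v (lift i j)).
    move=> j; apply: AZ => //.
    by rewrite subr_ge0 ler_pdivrMr// mul1r imax.
  rewrite (_ : \sum_j w j = \sum_j v j).
    by rewrite (bigD1_ord i)//= {1}/v divff ?gt_eqF// subrr scale0r add0r.
  rewrite /v; under [RHS]eq_bigr do rewrite scalerBl scale1r mulrC -scalerA.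
  by rewrite sumrB -scaler_sumr cw scaler0 subr0.
move=> x [n _]; have [nd|/ltnW dn] := leqP n d.
  by rewrite -(subnK nd); elim: (d - n)%N => // k IHk /IHk; exact: up.
rewrite -(subnK dn); elim: (n - d)%N => // k IHk kx.
by apply/IHk/down; rewrite ?leq_addl.
Qed.

Section Closed.
Variables (C : set V) (f : V) (e : R).
Hypotheses (e0 : 0 < e) (Cf : forall x, C x -> e * `|x| <= inner f x).

Let f_ge0 x : C x -> 0 <= inner f x.
Proof. by move=> /Cf; apply: le_trans; rewrite mulr_ge0// ltW. Qed.

Let slice_compact A c : closed A -> A `<=` C ->
  compact (A `&` [set x | inner f x <= c]).
Proof.
move=> Acl AC; apply: (@bounded_closed_compact_row _ _ _ (c / e)).
  move=> x [/AC Cx fx]; rewrite ler_pdivlMr// mulrC.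
  exact: le_trans (Cf Cx) _.
apply: closedI => //; apply: (@preimage_closed _ R (inner f) [set r | r <= c]).
  by move=> x _; exact: inner_continuous.
exact: closed_le.
Qed.

(** If [inner f (a + b)] is bounded then so are [a] and [b], since [f] is
    nonnegative on both: locally the sum is the image of a product of compact
    sets. *)
Lemma closed_minkowski_sum A B : closed A -> closed B -> A `<=` C -> B `<=` C ->
  closed (minkowski_sum A B).
Proof.
move=> Acl Bcl AC BC x ABx; pose c := inner f x + 1.
pose P := (A `&` [set x | inner f x <= c]) `*` (B `&` [set x | inner f x <= c]).
have Pco : compact P by apply: compact_setX; exact: slice_compact.
have PDcl : closed ((fun z : V * V => z.1 + z.2) @` P).
  apply: compact_closed; first exact: norm_hausdorff.
  apply: continuous_compact => //; apply: continuous_subspaceT.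
  exact: add_continuous.
have [|[a b] [/= [Aa _] [Bb _]] <-] := PDcl x; last by exists a => //; exists b.
move=> U Ux.
have Uc : nbhs x (U `&` [set y | inner f y < c]).
  apply: filterI => //; apply: open_nbhs_nbhs; split; last by rewrite /= ltrDl.
  apply: (@open_comp _ R (inner f) [set r | r < c]); last exact: open_lt.
  by move=> y _; exact: inner_continuous.
have [_ [[a Aa [b Bb <-]] [Uab /= abc]]] := ABx _ Uc.
exists (a + b); split => //; exists (a, b) => //.
have fa := f_ge0 (AC _ Aa); have fb := f_ge0 (BC _ Bb).
by move: abc; rewrite innerDr => abc; split; split => //=; lra.
Qed.

(** For fixed [x], the possible first summands [a] at stage [i] form a
    decreasing sequence of compact sets. *)
Lemma bigcap_minkowski_sum (A B : nat -> set V) :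
  (forall i, A i.+1 `<=` A i) -> (forall i, B i.+1 `<=` B i) ->
  (forall i, closed (A i)) -> (forall i, closed (B i)) ->
  (forall i, A i `<=` C) -> (forall i, B i `<=` C) ->
  \bigcap_i minkowski_sum (A i) (B i) `<=`
    minkowski_sum (\bigcap_i A i) (\bigcap_i B i).
Proof.
move=> Adec Bdec Acl Bcl AC BC x ABx.
pose T i := A i `&` [set a | B i (x - a)].
have Tcl i : closed (T i).
  apply: closedI => //; apply: (@preimage_closed V V (fun a => x - a) (B i)) => //.
  move=> a _; apply: (@continuousB R V V (fun=> x) id); first exact: cst_continuous.
  exact: cvg_id.
have Tco : compact (T 0%N).
  have Aco := slice_compact (c := inner f x) (Acl 0%N) (AC 0%N).
  apply: (subclosed_compact (Tcl 0%N) Aco).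
  move=> a [Aa Ba]; split => //=.
  have := f_ge0 (BC _ _ Ba); rewrite innerDr innerNr; lra.
have [||a Ta] := nested_compact _ Tcl Tco.
- by move=> i a [Aa Ba]; split; [exact: Adec|exact: Bdec].
- move=> i; have [a Aa [b Bb abx]] := ABx i I.
  by exists a; split => //=; rewrite -abx addrC addKr.
exists a; first by move=> i _; have [] := Ta i I.
exists (x - a); last by rewrite addrCA subrr addr0.
by move=> i _; have [] := Ta i I.
Qed.

Hypothesis Ccone : convex_cone C.

Lemma sums_sub A n : A `<=` C -> sums A n `<=` C.
Proof.
have [[C0 _] CD] := Ccone.
move=> AC x nx; have : cone_hull A x by exists n.
by move: x {nx}; exact: cone_hull_min.
Qed.

Lemma closed_sums A n : closed A -> A `<=` C -> closed (sums A n).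
Proof.
move=> Acl AC; elim: n => [|n IHn].
  rewrite sums0; apply: compact_closed; last exact: compact_set1.
  exact: norm_hausdorff.
by rewrite sumsS; apply: closed_minkowski_sum => //; exact: sums_sub.
Qed.

Lemma bigcap_sums (A : nat -> set V) n : (forall i, A i.+1 `<=` A i) ->
  (forall i, closed (A i)) -> (forall i, A i `<=` C) ->
  \bigcap_i sums (A i) n `<=` sums (\bigcap_i A i) n.
Proof.
move=> Adec Acl AC; elim: n => [|n IHn] x Ax.
  by have := Ax 0%N I; rewrite !sums0.
have : (\bigcap_i minkowski_sum (A i) (sums (A i) n)) x.
  by move=> i _; rewrite -sumsS; exact: Ax.
move=> /bigcap_minkowski_sum[]//.
- by move=> i y [w Aw ->]; exists w => // j; exact: Adec.
- by move=> i; exact: closed_sums.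
- by move=> i; exact: sums_sub.
move=> a Aa [b Bb <-]; rewrite sumsS; exists a => //; exists b => //.
exact: IHn.
Qed.

Lemma closed_cone_hull A : is_cone A -> closed A -> A `<=` C ->
  closed (cone_hull A).
Proof. by move=> Acone Acl AC; rewrite caratheodory//; exact: closed_sums. Qed.

(** By Caratheodory's theorem the number of summands is the same at every stage,
    so that [bigcap_sums] applies. *)
Lemma bigcap_cone_hull (A : nat -> set V) : (forall i, A i.+1 `<=` A i) ->
  (forall i, is_cone (A i)) -> (forall i, closed (A i)) -> (forall i, A i `<=` C) ->
  \bigcap_i cone_hull (A i) `<=` cone_hull (\bigcap_i A i).
Proof.
move=> Adec Acone Acl AC x Ax; exists d => //; apply: bigcap_sums => // i _.
by rewrite -caratheodory//; exact: Ax.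
Qed.

End Closed.
End ConeHull.

(** * Iterated closures of a pointed cone *)

Section ConeClosure.
Variables (R : realType) (d : nat).
Local Notation V := 'rV[R]_d.
Implicit Types (x y z w f : V) (t : R) (A B C F : set V).

Lemma is_coneI A B : is_cone A -> is_cone B -> is_cone (A `&` B).
Proof.
move=> [A0 AZ] [B0 BZ]; split => // x t t0 [Ax Bx].
by split; [exact: AZ|exact: BZ].
Qed.

Lemma is_cone_setD_bigcup (T : Type) (J : set T) (O : T -> set V) C :
  is_cone C -> (forall i, J i -> is_cone (~` O i)) ->
  is_cone (C `\` \bigcup_(i in J) O i).
Proof.
move=> Ccone Ocone; apply: is_coneI => //; split.
  by move=> [i Ji]; have [] := Ocone i Ji.
move=> x t t0 Ox [i Ji]; have [_ OZ] := Ocone i Ji.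
by apply: OZ => // Oix; apply: Ox; exists i.
Qed.

Section Faces.
Variables (C : set V) (g : V) (e : R).
Hypotheses (Ccone : convex_cone C) (Ccl : closed C).
Hypotheses (e0 : 0 < e) (Cg : forall x, C x -> e * `|x| <= inner g x).

Let g_ge0 x : C x -> 0 <= inner g x.
Proof. by move=> /Cg; apply: le_trans; rewrite mulr_ge0// ltW. Qed.

Let g_gt0 x : C x -> x != 0 -> 0 < inner g x.
Proof. by move=> /Cg + x0; apply: lt_le_trans; rewrite mulr_gt0// normr_gt0. Qed.

Record face F : Prop := Face {
  face_sub : F `<=` C;
  face_closed : closed F;
  face_cone : is_cone F;
  face_summand : forall x y, C x -> C y -> F (x + y) -> F x;
  face_neq0 : exists2 x, F x & x != 0 }.

(** The face where a functional is maximal relatively to [g]; the maximum exists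
    because the slice [inner g x = 1] of a face is compact. *)
Lemma face_argmax F h : face F -> exists m : R,
  (forall x, F x -> inner h x <= m * inner g x) /\
  face (F `&` [set x | inner h x = m * inner g x]).
Proof.
move=> [FC Fcl [F0 FZ] Fsum [a Fa a0]].
pose S := F `&` [set x | inner g x = 1].
have Sco : compact S.
  apply: (@bounded_closed_compact_row _ _ _ (e^-1)).
    by move=> x [/FC/Cg + gx]; rewrite gx -ler_pdivlMl// mulr1.
  apply: closedI => //; apply: (@preimage_closed _ R (inner g) [set r | r = 1]).
    by move=> x _; exact: inner_continuous.
  exact: closed_eq.
have nrm x : F x -> x != 0 -> S ((inner g x)^-1 *: x).
  move=> Fx x0; have gx := g_gt0 (FC _ Fx) x0; split.
    by apply: FZ => //; rewrite invr_ge0 ltW.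
  by rewrite /= innerZr mulVf// gt_eqF.
have [||p] := @compact_EVT_max _ R (inner h) S _ Sco.
- by exists ((inner g a)^-1 *: a); exact: nrm.
- by apply: continuous_subspaceT => x; exact: inner_continuous.
rewrite inE => -[Fp gp] pmax; exists (inner h p).
have hF x : F x -> inner h x <= inner h p * inner g x.
  move=> Fx; have [->|x0] := eqVneq x 0; first by rewrite !inner0r mulr0.
  have := pmax ((inner g x)^-1 *: x); rewrite inE => /(_ (nrm _ Fx x0)).
  by rewrite innerZr mulrC ler_pdivrMr// g_gt0//; exact: FC.
split => //; split.
- by move=> x [/FC].
- apply: closedI => //.
  rewrite (_ : [set x | _] = inner (h - inner h p *: g) @^-1` [set r | r = 0]).
    apply: preimage_closed; last exact: closed_eq.
    by move=> x _; exact: inner_continuous.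
  apply/seteqP; split => x /=; rewrite innerDl innerNl innerZl => /eqP.
    by move=> hx; apply/eqP; rewrite subr_eq0.
  by rewrite subr_eq0 => /eqP.
- apply: is_coneI => //; split; first by rewrite /= !inner0r mulr0.
  by move=> x t _ /= hx; rewrite !innerZr hx mulrCA.
- move=> x y Cx Cy [Fxy /=]; have Fx := Fsum _ _ Cx Cy Fxy.
  have Fy : F y by apply: (Fsum _ x) => //; rewrite addrC.
  have := hF _ Fx; have := hF _ Fy; rewrite !innerDr mulrDr => hy hx hxy.
  split => //=; lra.
- exists p; first by rewrite /= gp mulr1.
  apply: contra_eqN gp => /eqP->; by rewrite inner0r eq_sym oner_eq0.
Qed.

(** Passing to the maximal face for each coordinate in turn, starting from [f],
    reaches a single ray; by the face property, the summands in [C] of an element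
    of this ray all lie on it. *)
Lemma extreme_ray f w : C w -> 0 < inner f w -> exists a,
  [/\ C a, 0 < inner f a &
      forall B, is_cone B -> B `<=` C -> cone_hull B a -> B a].
Proof.
move=> Cw fw; have [[C0 CZ] CD] := Ccone.
have w0 : w != 0 by apply: contraTneq fw => ->; rewrite inner0r ltxx.
have fC : face C by split => //; exists w.
have [m [fm Fm]] := face_argmax f fC.
have m0 : 0 < m.
  by have := lt_le_trans fw (fm _ Cw); rewrite pmulr_lgt0// g_gt0.
set F1 := (X in face X) in Fm.
have [F [fF FF1 Fcoord]] : exists F, [/\ face F, F `<=` F1 &
    forall j, exists r : R, forall x, F x -> x ord0 j = r * inner g x].
  suff [F [fF FF1 Fs]] : exists F, [/\ face F, F `<=` F1 & forall j, j \in enum 'I_d ->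
      exists r : R, forall x, F x -> x ord0 j = r * inner g x].
    by exists F; split => // j; apply: Fs; rewrite mem_enum.
  elim: (enum 'I_d) => [|j s [F [fF FF1 Fs]]]; first by exists F1; split.
  have [r [_ fF']] := face_argmax (delta_mx ord0 j) fF.
  exists (F `&` [set x | inner (delta_mx ord0 j) x = r * inner g x]).
  split => // [x [/FF1//]|i]; rewrite inE => /predU1P[->|/Fs[r' Fr']].
    by exists r => x [_ /=]; rewrite inner_delta.
  by exists r' => x [/Fr'].
have [FC _ [F0 FZ] Fsum [a Fa a0]] := fF.
have ga := g_gt0 (FC _ Fa) a0.
have ray x : F x -> x = (inner g x / inner g a) *: a.
  move=> Fx; apply/rowP => j; rewrite mxE; have [r Fr] := Fcoord j.
  by rewrite (Fr _ Fx) (Fr _ Fa) mulrCA -mulrA mulVf ?gt_eqF// mulr1.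
exists a; split; first exact: FC.
  by have [_ /= ->] := FF1 _ Fa; rewrite mulr_gt0.
move=> B [_ BZ] BC [n _ [v Bv av]].
have Fv i : F (v i).
  apply: (Fsum _ (\sum_(j < n | j != i) v j)); first exact: BC.
    by elim/big_ind: _ => // j _; exact: BC.
  by move: Fa; rewrite av (bigD1 i).
have [i vi0] : exists i, v i != 0.
  apply/existsP; rewrite -negb_forall; apply: contra a0 => /forallP v0.
  by rewrite av big1// => i _; exact/eqP.
have gv := g_gt0 (FC _ (Fv i)) vi0.
have -> : a = (inner g a / inner g (v i)) *: v i.
  rewrite [X in _ *: X](ray _ (Fv i)) scalerA mulrA divfK ?gt_eqF//.
  by rewrite divff ?gt_eqF// scale1r.
by apply: BZ => //; rewrite divr_ge0 ?ltW.
Qed.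

End Faces.

Section Closure.
Variables (T : Type) (J : set T) (O : T -> set V).

(** The homogeneous counterpart of [R_closure]. *)
Definition cone_step C := \bigcap_(i in J) cone_hull (C `\` O i).

Lemma convex_cone_step C : (forall i, J i -> is_cone (~` O i)) ->
  convex_cone C -> convex_cone (cone_step C).
Proof.
move=> Ocone [Ccone CD].
have Hcone i : J i -> convex_cone (cone_hull (C `\` O i)).
  by move=> Ji; apply/convex_cone_hull/is_coneI => //; exact: Ocone.
split; first split.
- by move=> i /Hcone[[]].
- by move=> x t t0 Cx i Ji; have [[_ HZ] _] := Hcone _ Ji; apply/HZ/Cx.
- by move=> x y Cx Cy i Ji; apply: cone_hullD; [exact: Cx|exact: Cy].
Qed.

Lemma cone_step_sub C : J !=set0 -> convex_cone C -> cone_step C `<=` C.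
Proof.
move=> [i Ji] [[C0 _] CD] x /(_ i Ji).
by apply: cone_hull_min => // y [].
Qed.

(** The intersection of the iterates is reproduced by every
    [C |-> cone_hull (C `\` O i)], because hulls commute with decreasing
    intersections. An extreme ray of it therefore avoids every [O i], and a
    pointed closed cone is determined by its extreme rays. *)
Theorem bigcap_cone_step C : J !=set0 ->
  (forall i, J i -> open (O i)) -> (forall i, J i -> is_cone (~` O i)) ->
  convex_cone C -> closed C -> pointed C ->
  \bigcap_n iter n cone_step C = cone_hull (C `\` \bigcup_(i in J) O i).
Proof.
move=> J0 Oop Ocone Ccone Ccl Cpt.
have [g [e e0 Cg]] := pointed_cone_functional Ccone Ccl Cpt.
have inv A : convex_cone A -> closed A -> A `<=` C ->
    [/\ convex_cone (cone_step A), closed (cone_step A) & cone_step A `<=` A].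
  move=> Acone Acl AC; have [[A0 AZ] AD] := Acone.
  have Dcone i : J i -> is_cone (A `\` O i).
    by move=> Ji; apply: is_coneI; [exact: Acone.1|exact: Ocone].
  split; [exact: convex_cone_step| |exact: cone_step_sub].
  apply: closed_bigI => i Ji; apply: (closed_cone_hull e0 Cg) => //.
  - exact: Dcone.
  - by rewrite setDE; apply: closedI => //; apply/open_closedC/Oop.
  - by move=> x [/AC].
pose K n := iter n cone_step C.
have KP n : [/\ convex_cone (K n), closed (K n) & K n `<=` C].
  elim: n => [|n [Kco Kcl KC]]; first by split.
  by have [? ? KK] := inv _ Kco Kcl KC; split => // x /KK/KC.
have KS n : K n.+1 `<=` K n by have [Kco Kcl KC] := KP n; have [] := inv _ Kco Kcl KC.
pose Koo := \bigcap_n K n.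
have KooC : Koo `<=` C by move=> x /(_ 0%N I).
have Koocl : closed Koo by apply: closed_bigI => n _; have [] := KP n.
have Koocone : convex_cone Koo.
  split; first split.
  - by move=> n _; have [[[]]] := KP n.
  - by move=> x t t0 Kx n _; have [[[_ KZ] _] _ _] := KP n; apply/KZ/Kx.
  - by move=> x y Kx Ky n _; have [[_ KD] _ _] := KP n; apply: KD; [exact: Kx|exact: Ky].
have KooO i : J i -> Koo `<=` cone_hull (Koo `\` O i).
  move=> Ji; rewrite (_ : Koo `\` O i = \bigcap_n (K n `\` O i)); last first.
    apply/seteqP; split => [x [Kx Ox] n _|x Kx]; first by split => //; exact: Kx.
    by split; [move=> n _; have [] := Kx n I|have [] := Kx 0%N I].
  move=> x Kx; apply: (bigcap_cone_hull e0 Cg) => //.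
  - by move=> n y [/KS].
  - by move=> n; apply: is_coneI; [have [[]] := KP n|exact: Ocone].
  - move=> n; rewrite setDE; apply: closedI; first by have [] := KP n.
    exact/open_closedC/Oop.
  - by move=> n y [Ky _]; have [_ _] := KP n; exact.
  - by move=> n _; exact: (Kx n.+1 I i Ji).
set D := C `\` \bigcup_(i in J) O i.
have Dcone : is_cone D by apply: is_cone_setD_bigcup => //; case: Ccone.
have DC : D `<=` C by move=> x [].
have Dcl : closed D.
  rewrite /D setDE; apply: closedI => //; apply: open_closedC.
  exact: bigcup_open.
apply/seteqP; split => [w Kw|]; last first.
  have [[Koo0 _] KooD] := Koocone; apply: cone_hull_min => // x [Cx Ox] n _.
  elim: n => // n IHn i Ji; apply: sub_cone_hull; split => // Oi.
  by apply: Ox; exists i.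
(* otherwise a functional separating w from the hull of D is positive on an
   extreme ray a of Koo; since a is not in D it lies in some O i, although it
   is a sum of elements of Koo outside O i *)
apply: contrapT => nDw.
have [f fw fD] := cone_separation (convex_cone_hull Dcone)
  (closed_cone_hull e0 Cg Ccone Dcone Dcl DC) nDw.
have [a [Ka fa aext]] := extreme_ray Koocone Koocl e0
  (fun x Kx => Cg x (KooC x Kx)) Kw fw.
have [[i Ji Oa]|nO] := pselect ((\bigcup_(i in J) O i) a).
  have [||//] := aext (Koo `\` O i) _ _ (KooO i Ji a Ka).
  - by apply: is_coneI; [have [] := Koocone|exact: Ocone].
  - by move=> x [].
have : inner f a <= 0 by apply/fD/sub_cone_hull; split => //; exact: KooC.
by rewrite leNgt fa.
Qed.

End Closure.
End ConeClosure.

(** * Convex sets and recession directions *)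

Section Convex.
Variables (R : realType) (d : nat).
Local Notation V := 'rV[R]_d.
Implicit Types (x y z v : V) (t : R) (A B K L : set V).

Lemma is_convexP A : is_convex A <-> forall x y t,
  0 <= t <= 1 -> A x -> A y -> A (t *: x + (1 - t) *: y).
Proof.
split=> [cA x y t /andP[t0 t1] Ax Ay|cA x y t].
  by have := cA x y (Itv01 t0 t1); rewrite !inE; apply.
by rewrite !inE; apply: cA; apply/andP; split; [exact: ge0|exact: le1].
Qed.

Lemma convex_convex_hull A : is_convex (convex_hull A).
Proof.
apply/is_convexP => x y t t01 Ax Ay B [Bco AB].
by apply: (iffLR (is_convexP B) Bco) => //; [exact: Ax|exact: Ay].
Qed.

Lemma convex_hull_combination A x y t : 0 <= t <= 1 ->
  convex_hull A x -> convex_hull A y -> convex_hull A (t *: x + (1 - t) *: y).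
Proof. by apply: (iffLR (is_convexP _)); exact: convex_convex_hull. Qed.

Lemma convex_translate A v : is_convex A -> is_convex [set x | A (x + v)].
Proof.
move=> /is_convexP cA; apply/is_convexP => x y t t01 /= Ax Ay.
have -> : t *: x + (1 - t) *: y + v = t *: (x + v) + (1 - t) *: (y + v).
  by rewrite !scalerDr addrACA -scalerDl [t + _]addrC subrK scale1r.
exact: cA.
Qed.

Lemma closed_limit_segment A p q : closed A ->
  (forall t, 0 < t <= 1 -> A (p + t *: q)) -> A p.
Proof.
move=> Acl Apq; apply: Acl => U /nbhs_ballP[r /= r0 rU].
pose t := Num.min 1 (r / 2 / (`|q| + 1)).
have q1 : 0 < `|q| + 1 by rewrite ltr_wpDl.
have t0 : 0 < t by rewrite lt_min ltr01 !divr_gt0.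
have tr : t * (`|q| + 1) <= r / 2 by rewrite -ler_pdivlMr// ge_min lexx orbT.
exists (p + t *: q); split; first by apply: Apq; rewrite t0 ge_min lexx.
apply: rU; rewrite -ball_normE /= opprD addrA subrr add0r normrN normrZ gtr0_norm//.
have := normr_ge0 q; nra.
Qed.

(** Otherwise the ray from [x] would stay in [L] from [x + v] on, so that [v], and
    hence [- v], would be a recession direction of [L]; the latter would carry
    the interior point [x + v] back to [x]. *)
Lemma ray_leaves L x v : closed_convex L -> is_linear_space (rec_cone L) ->
  ~ interior L x -> interior L (x + v) -> exists2 t, 1 < t & ~ L (x + t *: v).
Proof.
move=> [Lcl /is_convexP Lco] [U recU] nLx Lxv; apply: contrapT => nleave.
have Lray t : 1 < t -> L (x + t *: v).
  by move=> t1; apply: contrapT => nLt; apply: nleave; exists t.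
have rec_v : rec_cone L v.
  move=> z Lz t; rewrite le_eqVlt => /predU1P[<-|t0]; first by rewrite scale0r addr0.
  apply: (@closed_limit_segment _ _ (x + v - z)) => // e /andP[e0 e1].
  have := Lco (x + (1 + t / e) *: v) z e; rewrite e1 ltW// => /(_ isT).
  move=> /(_ (Lray _ _)); rewrite ltrDl divr_gt0// => /(_ isT Lz).
  by congr L; apply/rowP => j; rewrite !mxE; field; rewrite gt_eqF.
have rec_Nv : rec_cone L (- v) by move: rec_v; rewrite recU /= memvN.
apply: nLx; rewrite /interior.
have : \forall y \near x, L (y + v).
  have vcont : {for x, continuous (fun y => y + v)}.
    by apply: (@continuousD R V V id (fun=> v)); [exact: cvg_id|exact: cst_continuous].
  exact: vcont.
by apply: filterS => y /rec_Nv /(_ 1 ler01); rewrite scale1r addrK.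
Qed.

End Convex.

(** * Homogenization: convex sets as slices of cones *)

Section Homogenization.
Variables (R : realType) (d : nat).
Local Notation V := 'rV[R]_d.
Local Notation W := 'rV[R]_(1 + d).
Implicit Types (x y z v : V) (t : R) (w : W) (K L : set V) (A B C : set W).

Definition height w : R := w ord0 (lshift d ord0).

Definition homog t x : W := row_mx t%:M x.

Lemma height_homog t x : height (homog t x) = t.
Proof.
by rewrite /height row_mxEl mxE eqxx mulr1n.
Qed.

Lemma rsubmx_homog t x : rsubmx (homog t x) = x.
Proof. exact: row_mxKr. Qed.

Lemma homogE w : w = homog (height w) (rsubmx w).
Proof.
rewrite -[LHS]hsubmxK; congr row_mx; apply/matrixP => i j.
by rewrite !ord1 !mxE eqxx mulr1n.
Qed.

Lemma heightD w w' : height (w + w') = height w + height w'.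
Proof. by rewrite /height mxE. Qed.

Lemma heightZ t w : height (t *: w) = t * height w.
Proof. by rewrite /height mxE. Qed.

Lemma rsubmxD w w' : rsubmx (w + w') = rsubmx w + rsubmx w' :> V.
Proof. by apply/rowP => j; rewrite !mxE. Qed.

Lemma rsubmxZ t w : rsubmx (t *: w) = t *: rsubmx w :> V.
Proof. by apply/rowP => j; rewrite !mxE. Qed.

Lemma homogD t t' x x' : homog t x + homog t' x' = homog (t + t') (x + x').
Proof. by rewrite /homog add_row_mx raddfD. Qed.

Lemma homogZ t t' x : t *: homog t' x = homog (t * t') (t *: x).
Proof. by rewrite /homog scale_row_mx scale_scalar_mx. Qed.

Lemma height_continuous : continuous height.
Proof. exact: coord_continuous. Qed.

Lemma rsubmx_continuous : continuous (fun w => rsubmx w : V).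
Proof.
move=> w U /nbhs_ballP[e e0 eU]; apply/nbhs_ballP; exists e => //= z [_ wz].
by apply: eU; split => // i j; rewrite !mxE; exact: wz.
Qed.

Definition slice A : set V := [set x | A (homog 1 x)].

Lemma convex_slice A : convex_cone A -> is_convex (slice A).
Proof.
move=> [[_ AZ] AD]; apply/is_convexP => x y t /andP[t0 t1] Ax Ay; rewrite /slice /=.
have -> : homog 1 (t *: x + (1 - t) *: y) = t *: homog 1 x + (1 - t) *: homog 1 y.
  by rewrite !homogZ homogD !mulr1 [t + _]addrC subrK.
by apply: AD; apply: AZ; rewrite ?subr_ge0.
Qed.

(** The cone over [K] completed by its recession directions at height 0. This
    form of the conditions (every [k + s (y / l - k)], with [s = t l < 1], lies
    in [K]) makes closedness evident and treats both heights at once. *)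
Definition cone_over K : set W := [set w | 0 <= height w /\
  forall k t, K k -> 0 <= t -> t * height w < 1 ->
    K ((1 - t * height w) *: k + t *: rsubmx w)].

Section ConeOver.
Variable K : set V.
Hypotheses (K0 : K !=set0) (Kcc : closed_convex K).

Lemma slice_cone_over : slice (cone_over K) = K.
Proof.
have [Kcl /is_convexP Kco] := Kcc.
apply/seteqP; split => x; rewrite /slice /cone_over /= height_homog rsubmx_homog.
  move=> [_ Kx]; have [k Kk] := K0.
  apply: (@closed_limit_segment _ _ _ _ (k - x)) => // t /andP[t0 t1].
  have := Kx k (1 - t) Kk; rewrite mulr1 subKr subr_ge0 => /(_ t1).
  rewrite ltrBlDr ltrDl => /(_ t0); congr K.
  by apply/rowP => j; rewrite !mxE; ring.
move=> Kx; split => // k t Kk t0; rewrite mulr1 => t1.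
by rewrite addrC; apply: Kco => //; rewrite t0 ltW.
Qed.

Lemma cone_over_homog0 v : cone_over K (homog 0 v) <-> rec_cone K v.
Proof.
rewrite /cone_over /= height_homog rsubmx_homog; split.
  move=> [_ Kv] k Kk t t0; have := Kv k t Kk t0.
  by rewrite mulr0 subr0 scale1r; apply.
move=> Kv; split=> // k t Kk t0 _; rewrite mulr0 subr0 scale1r; exact: Kv.
Qed.

Lemma convex_cone_cone_over : convex_cone (cone_over K).
Proof.
split; first split.
- rewrite (_ : 0 = homog 0 0); last by rewrite /homog raddf0 row_mx0.
  by apply/cone_over_homog0 => k Kk t _; rewrite scaler0 addr0.
- move=> w s s0 [w0 Kw]; rewrite /cone_over /= heightZ rsubmxZ mulr_ge0//; split => //.
  move=> k t Kk t0; rewrite mulrA scalerA; apply: Kw => //; exact: mulr_ge0.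
- move=> w w' [w0 Kw] [w'0 Kw']; rewrite /cone_over /= heightD rsubmxD addr_ge0//.
  split=> // k t Kk t0 tww'.
  have tw' : t * height w' < 1.
    by rewrite (le_lt_trans _ tww')// mulrDr lerDr mulr_ge0.
  have r0 : 0 < 1 - t * height w' by rewrite subr_gt0.
  (* first move towards w, by an amount compensating the later contraction *)
  have := Kw k (t / (1 - t * height w')) Kk; rewrite divr_ge0// ?ltW// => /(_ isT).
  rewrite mulrAC ltr_pdivrMr// mul1r ltrBrDr -mulrDr => /(_ tww') Kk'.
  have := Kw' _ t Kk' t0 tw'; congr K.
  by apply/rowP => j; rewrite !mxE; field; rewrite gt_eqF.
Qed.

Lemma closed_cone_over : closed (cone_over K).
Proof.
have [Kcl _] := Kcc.
have -> : cone_over K = [set w | 0 <= height w] `&`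
    \bigcap_(k in K) \bigcap_(t in [set t : R | 0 <= t])
      ([set w | 1 <= t * height w] `|`
       [set w | K ((1 - t * height w) *: k + t *: rsubmx w)]).
  apply/seteqP; split => w [w0 Kw]; split => //.
    move=> k Kk t t0; have [tw|tw] := leP 1 (t * height w); first by left.
    by right; exact: Kw.
  by move=> k t Kk t0 tw; case: (Kw k Kk t t0) => //=; rewrite leNgt tw.
apply: closedI.
  apply: (@preimage_closed _ R height [set r | 0 <= r]); last exact: closed_ge.
  by move=> w _; exact: height_continuous.
apply: closed_bigI => k _; apply: closed_bigI => t _.
have hc : continuous (fun w => t * height w).
  move=> w; apply: (@continuousM R _ (fun=> t) height w); first exact: cst_continuous.
  exact: height_continuous.
apply: closedU.
  apply: (@preimage_closed _ R (fun w => t * height w) [set r | 1 <= r]).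
    by move=> w _; exact: hc.
  exact: closed_ge.
apply: (@preimage_closed W V (fun w => (1 - t * height w) *: k + t *: rsubmx w)) => //.
move=> w _; apply: (@continuousD R V W); apply: continuousZ.
- by apply: (@continuousB R R W (fun=> 1)); [exact: cst_continuous|exact: hc].
- exact: cst_continuous.
- exact: cst_continuous.
- exact: rsubmx_continuous.
Qed.

Lemma pointed_cone_over : line_free K -> pointed (cone_over K).
Proof.
move=> Klf w Kw KNw; have [h0 _] := Kw; have [h0' _] := KNw.
have hw : height w = 0.
  by apply/eqP; rewrite eq_le h0 andbT -oppr_ge0 -mulN1r -heightZ scaleN1r.
have Ew := homogE w; rewrite hw in Ew.
have ENw : - w = homog 0 (- rsubmx w).
  by rewrite -scaleN1r [in LHS]Ew homogZ mulr0 scaleN1r.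
rewrite Ew in Kw; rewrite ENw in KNw.
move/cone_over_homog0: Kw => rw; move/cone_over_homog0: KNw => rNw.
suff w0 : rsubmx w = 0 :> V by rewrite Ew w0 /homog raddf0 row_mx0.
apply/eqP/negPn/negP => w0; apply: Klf; have [k Kk] := K0.
exists k, (rsubmx w); split => // t.
have [t0|/ltW t0] := leP 0 t; first exact: rw.
by rewrite -[t]opprK scaleNr -scalerN; apply: rNw; rewrite // oppr_ge0.
Qed.

End ConeOver.

Definition open_cone_over L : set W :=
  [set w | 0 < height w /\ interior L ((height w)^-1 *: rsubmx w)].

Lemma slice_open_cone_over L : slice (open_cone_over L) = interior L.
Proof.
apply/seteqP; split => x;
  rewrite /slice /open_cone_over /= height_homog rsubmx_homog invr1 scale1r.
  by case.
by move=> Lx; split.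
Qed.

Lemma open_open_cone_over L : open (open_cone_over L).
Proof.
rewrite openE => w [w0 Lw].
have h0 : \forall z \near w, 0 < height z.
  apply: open_nbhs_nbhs; split => //.
  apply: (@open_comp _ R height [set r | 0 < r]); last exact: open_gt.
  by move=> z _; exact: height_continuous.
have bc : {for w, continuous (fun z : W => (height z)^-1 *: (rsubmx z : V))}.
  apply: continuousZ; last exact: rsubmx_continuous.
  by apply: continuousV; [rewrite gt_eqF|exact: height_continuous].
have hL : \forall z \near w, interior L ((height z)^-1 *: rsubmx z).
  by apply: bc; apply: open_nbhs_nbhs; split => //; exact: open_interior.
by apply: filterS2 h0 hL.
Qed.

Lemma is_cone_setC_open_cone_over L : is_cone (~` open_cone_over L).
Proof.
split=> [[]|w t t0 nLw]; first by rewrite /height mxE ltxx.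
move=> [htw Ltw]; apply: nLw; move: htw Ltw; rewrite heightZ rsubmxZ.
have [->|tn0] := eqVneq t 0; first by rewrite mul0r ltxx.
have tp : 0 < t by rewrite lt_def tn0.
rewrite pmulr_rgt0// => hw; rewrite scalerA invfM mulrAC mulVf// mul1r => Lw.
by split.
Qed.

(** The summands of positive height make up a convex combination, those of
    height zero a recession direction. *)
Lemma slice_cone_hull A x : is_cone A -> A `<=` [set w | 0 <= height w] ->
  slice (cone_hull A) x -> exists p v, [/\ x = p + v, convex_hull (slice A) p &
    cone_hull (A `&` [set w | height w = 0]) (homog 0 v)].
Proof.
move=> Acone Ah.
pose Z := cone_hull (A `&` [set w | height w = 0]).
pose T w := (height w = 0 /\ Z w) \/ (0 < height w /\ exists p v,
  [/\ rsubmx w = height w *: p + v, convex_hull (slice A) p & Z (homog 0 v)]).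
have [A0 AZ] := Acone.
have ZZ0 : Z 0 by exists 0%N => //; rewrite sums0.
have homog00 : homog 0 0 = 0 by rewrite /homog raddf0 row_mx0.
suff AT : cone_hull A `<=` T.
  move=> /AT; rewrite /T height_homog rsubmx_homog => -[[/eqP]|].
    by rewrite oner_eq0.
  by move=> [_ [p [v [-> pA vZ]]]]; exists p, v; rewrite scale1r.
apply: cone_hull_min; first by left; rewrite /height mxE.
  have mixed w w' : height w = 0 -> Z w -> 0 < height w' -> (exists p v,
      [/\ rsubmx w' = height w' *: p + v, convex_hull (slice A) p & Z (homog 0 v)]) ->
      T (w + w').
    move=> w0 Zw w'0 [p [v [w'E pA vZ]]]; right; rewrite heightD w0 add0r; split=> //.
    exists p, (rsubmx w + v); rewrite rsubmxD w'E addrCA; split => //.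
    rewrite -[0]addr0 -homogD; apply: cone_hullD => //.
    by move: Zw; rewrite {1}(homogE w) w0.
  move=> w w' [[w0 Zw]|[w0 Tw]] [[w'0 Zw']|[w'0 Tw']].
  - by left; rewrite heightD w0 w'0 addr0; split => //; exact: cone_hullD.
  - exact: mixed.
  - by rewrite addrC; exact: mixed.
  - right; have [p [v [wE pA vZ]]] := Tw; have [p' [v' [w'E pA' vZ']]] := Tw'.
    have h0 : 0 < height w + height w' by exact: addr_gt0.
    rewrite heightD; split => //; pose s := height w / (height w + height w').
    exists (s *: p + (1 - s) *: p'), (v + v'); split.
    + rewrite rsubmxD wE w'E addrACA; congr (_ + _).
      rewrite scalerDr !scalerA; congr (_ *: _ + _ *: _); rewrite /s; field;
        by rewrite gt_eqF.
    + apply: convex_hull_combination => //.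
      rewrite /s; apply/andP; split; first by rewrite divr_ge0 ?ltW.
      by rewrite ler_pdivrMr// mul1r lerDl ltW.
    + by rewrite -[0]addr0 -homogD; exact: cone_hullD.
move=> w Aw; have := Ah _ Aw; rewrite /= le_eqVlt => /predU1P[/esym w0|w0].
  by left; split => //; exact: sub_cone_hull.
right; split => //; exists ((height w)^-1 *: rsubmx w), 0; split.
- by rewrite scalerA divff ?gt_eqF// scale1r addr0.
- apply: sub_gen_smallest; rewrite /slice /=.
  have -> : homog 1 ((height w)^-1 *: rsubmx w) = (height w)^-1 *: w.
    by rewrite [X in _ = _ *: X](homogE w) homogZ mulVf ?gt_eqF.
  by apply: AZ => //; rewrite invr_ge0 ltW.
- by rewrite homog00.
Qed.

(** A point of the left-hand side is the sum of a point of [R_set L (slice C)]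
    and a direction [v] of [C], so it suffices to translate generators [y] by
    [v]: either [y + v] is outside the interior of [L], or it lies between [y]
    and a later point of the ray from [y] that has left [L]. *)
Lemma slice_cone_hullD C L : closed_convex L -> is_linear_space (rec_cone L) ->
  convex_cone C -> C `<=` [set w | 0 <= height w] ->
  slice (cone_hull (C `\` open_cone_over L)) = R_set L (slice C).
Proof.
move=> Lcc Lrec Ccone Ch; have [Cc CD] := Ccone; have [C0 CZ] := Cc.
have Dcone : is_cone (C `\` open_cone_over L).
  by apply: is_coneI => //; exact: is_cone_setC_open_cone_over.
have sliceD : slice (C `\` open_cone_over L) = slice C `\` interior L.
  by rewrite -slice_open_cone_over.
apply/seteqP; split => [x|]; last first.
  apply: smallest_sub; first exact/convex_slice/convex_cone_hull.
  by rewrite -sliceD => x Dx; exact: (@sub_cone_hull _ _ _ (homog 1 x) Dx).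
have Dh : C `\` open_cone_over L `<=` [set w | 0 <= height w] by move=> w [/Ch].
move=> /(slice_cone_hull Dcone Dh)[p [v [-> + vC]]]; rewrite sliceD => pC.
have {}vC : C (homog 0 v).
  by move: vC; apply: cone_hull_min => // w [[]].
pose B := [set y | R_set L (slice C) (y + v)].
have Bco : is_convex B by apply/convex_translate/convex_convex_hull.
suff CB : slice C `\` interior L `<=` B by exact: (smallest_sub Bco CB) pC.
move=> y [Cy nLy].
have Cyt t : 0 <= t -> slice C (y + t *: v).
  move=> t0; rewrite /slice /= -[1]addr0 -[0](mulr0 t) -homogD -homogZ.
  by apply: CD => //; exact: CZ.
have [Lyv|nLyv] := pselect (interior L (y + v)); last first.
  apply: sub_gen_smallest; split => //.
  by have := Cyt 1 ler01; rewrite scale1r.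
have [t t1 nLt] := ray_leaves Lcc Lrec nLy Lyv.
have t0 : 0 < t by exact: lt_trans t1.
rewrite /B /=.
have -> : y + v = t^-1 *: (y + t *: v) + (1 - t^-1) *: y.
  rewrite scalerDr scalerA mulVf ?gt_eqF// scale1r addrAC -scalerDl.
  by rewrite [_ + (1 - _)]addrC subrK scale1r.
apply: convex_hull_combination.
- by rewrite invr_ge0 ltW//= invf_le1// ltW.
- apply: sub_gen_smallest; split; first by apply: Cyt; exact: ltW.
  by move=> /interior_subset.
- exact: sub_gen_smallest.
Qed.

End Homogenization.

(** * The closures of a line-free closed convex set *)

Section PartOne.
Variables (R : realType) (d : nat).

Lemma bigcap_R_iter (LL : set (set 'rV[R]_d)) (K : set 'rV[R]_d) :
  LL !=set0 -> (forall L, LL L -> closed_convex L) ->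
  (forall L, LL L -> is_linear_space (rec_cone L)) ->
  closed_convex K -> line_free K ->
  \bigcap_(i in [set: nat]) R_iter LL i K =
    minkowski_sum (convex_hull (K `&` uncovered LL)) (rec_cone K).
Proof.
move=> LL0 LLcc LLrec Kcc Klf.
have [->|/set0P K0] := eqVneq K set0.
  rewrite set0I; apply/seteqP; split => [x /(_ 0%N I)//|y [x x0 _]].
  have hull0 : convex_hull set0 `<=` (set0 : set 'rV[R]_d).
    by apply: smallest_sub => //; apply/is_convexP.
  by have := hull0 _ x0.
pose C n := iter n (cone_step LL (@open_cone_over R d)) (cone_over K).
have Ocone L : LL L -> is_cone (~` open_cone_over L).
  by move=> _; exact: is_cone_setC_open_cone_over.
have CP n : convex_cone (C n) /\ C n `<=` [set w | 0 <= height w].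
  elim: n => [|n [Cco Ch]]; first by split; [exact: convex_cone_cone_over|move=> w []].
  split; first exact: convex_cone_step.
  by move=> w /(cone_step_sub LL0 Cco)/Ch.
have CE n : R_iter LL n K = slice (C n).
  elim: n => [|n IHn]; first by rewrite slice_cone_over.
  have [Cco Ch] := CP n.
  rewrite /R_iter iterS -/(R_iter LL n K) IHn /R_closure.
  apply/seteqP; split => x Cx L LLL; have := Cx L LLL.
    by rewrite -slice_cone_hullD//; [exact: LLcc|exact: LLrec].
  by rewrite -slice_cone_hullD//; [exact: LLcc|exact: LLrec].
have -> : \bigcap_(i in [set: nat]) R_iter LL i K = slice (\bigcap_n C n).
  by apply/seteqP; split => x Cx n _; have := Cx n I; rewrite CE.
rewrite bigcap_cone_step//; last 4 first.
- by move=> L _; exact: open_open_cone_over.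
- exact: convex_cone_cone_over.
- exact: closed_cone_over.
- exact: pointed_cone_over.
set D := _ `\` _.
have Dcone : is_cone D.
  by apply: is_cone_setD_bigcup => //; have [] := convex_cone_cone_over K.
have sliceD : slice D = K `&` uncovered LL.
  rewrite -[in RHS](slice_cone_over K0 Kcc) /uncovered; apply/seteqP.
  split=> x [Kx Ux]; split => // -[L LLL Lx]; apply: Ux; exists L => //.
    by rewrite -slice_open_cone_over in Lx.
  by rewrite -slice_open_cone_over.
have Dh : D `<=` [set w | 0 <= height w] by move=> w [[]].
have [[_ HZ] HD] := convex_cone_hull Dcone.
apply/seteqP; split => [x /(slice_cone_hull Dcone Dh)|_ [p pD [v Kv <-]]].
  move=> [p [v [-> + vD]]]; rewrite sliceD => pD; exists p => //; exists v => //.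
  apply/cone_over_homog0; move: vD.
  have [[K00 _] KD] := convex_cone_cone_over K.
  by apply: cone_hull_min => // w [[]].
rewrite /slice /= -[1]addr0 -homogD; apply: HD.
  have Dco : is_convex (slice (cone_hull D)) by apply/convex_slice/convex_cone_hull.
  suff DD : K `&` uncovered LL `<=` slice (cone_hull D) by exact: (smallest_sub Dco DD).
  by rewrite -sliceD => x Dx; exact: (@sub_cone_hull _ _ _ (homog 1 x) Dx).
apply: sub_cone_hull; split; first exact/cone_over_homog0.
by move=> [L _ []]; rewrite height_homog ltxx.
Qed.

End PartOne.

(** * Rational polyhedra and mixed-integer points *)

Section RationalCone.
Variable R : realType.

Local Notation ratmx := (map_mx (ratr : rat -> R)).

(** Replace the coordinates of a point one at a time: a real coordinate lies
    between two rational ones that keep the point within [e] of [c]. *)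
Lemma convex_rational_points r (B : set 'rV[R]_r) (c : 'rV[R]_r) (e : R) :
  0 < e -> is_convex B ->
  (forall q : 'rV[rat]_r, (forall j, `|c ord0 j - ratr (q ord0 j)| < e) ->
    B (ratmx q)) ->
  B c.
Proof.
move=> e0 /is_convexP Bco Bq.
suff ind (s : seq 'I_r) (x : 'rV[R]_r) : (forall j, `|c ord0 j - x ord0 j| < e) ->
    (forall j, j \notin s -> exists q : rat, x ord0 j = ratr q) -> B x.
  by apply: (ind (enum 'I_r)) => j; rewrite ?subrr ?normr0// mem_enum.
elim: s x => [|k s IHs] x xe xq.
  have /choice[q qx] : forall j, exists q : rat, x ord0 j = ratr q by move=> j; exact: xq.
  have -> : x = ratmx (\row_j q j) by apply/rowP => j; rewrite !mxE.
  by apply: Bq => j; rewrite mxE -qx.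
have := xe k; rewrite ltr_distl => /andP[xk1 xk2].
have [p1] : exists q : rat, ratr q \in `](c ord0 k - e), (x ord0 k)[.
  by apply: rat_in_itvoo; rewrite ltrBlDr -ltrBlDl; move: xk1 xk2; lra.
rewrite in_itv /= => /andP[p1l p1r].
have [p2] : exists q : rat, ratr q \in `](x ord0 k), (c ord0 k + e)[.
  by apply: rat_in_itvoo; move: xk1 xk2; lra.
rewrite in_itv /= => /andP[p2l p2r].
pose set_k p : 'rV[R]_r := \row_j (if j == k then ratr p else x ord0 j).
have Bk p : c ord0 k - e < ratr p < c ord0 k + e -> B (set_k p).
  move=> /andP[pl pr]; apply: IHs => j.
    rewrite mxE; case: eqP => [->|_]; last exact: xe.
    by rewrite ltr_distlC; apply/andP.
  move=> js; rewrite mxE; case: eqP => [_|jk]; first by exists p.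
  by apply: xq; rewrite inE negb_or js andbT; apply/eqP.
have p12 : 0 < ratr p2 - ratr p1 :> R by rewrite subr_gt0 (lt_trans p1r).
pose t := (ratr p2 - x ord0 k) / (ratr p2 - ratr p1).
have -> : x = t *: set_k p1 + (1 - t) *: set_k p2.
  apply/rowP => j; rewrite !mxE; case: eqP => [->|_]; last by ring.
  by rewrite /t; field; rewrite gt_eqF.
apply: Bco.
- rewrite /t; apply/andP; split; first by rewrite divr_ge0// ?ltW// subr_gt0.
  by rewrite ler_pdivrMr// mul1r lerD2l lerN2 ltW.
- by apply: Bk; rewrite p1l /=; move: p1r xk1 xk2; lra.
- by apply: Bk; rewrite p2r andbT; move: p2l xk1 xk2; lra.
Qed.

(** The constraints that are tight at [v] cut out a rational subspace, and [v]
    satisfies the other ones with slack: so a neighbourhood of [v] in that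
    subspace, where rational points are dense, lies in the cone. *)
Lemma rational_cone_ind d n (a : 'I_n -> 'rV[rat]_d) (B : set 'rV[R]_d) v :
  is_convex B ->
  (forall q : 'rV[rat]_d, (forall i, inner (ratmx q) (ratmx (a i)) <= 0) ->
    B (ratmx q)) ->
  (forall i, inner v (ratmx (a i)) <= 0) -> B v.
Proof.
move=> /is_convexP Bco Bq va.
pose tight := [pred i | inner v (ratmx (a i)) == 0].
pose T : 'M[rat]_(d, n) := \matrix_(j, i) (if tight i then a i ord0 j else 0).
have mulT (u : 'rV[R]_d) i :
    (u *m ratmx T) ord0 i = if tight i then inner u (ratmx (a i)) else 0.
  rewrite mxE; case: ifP => ti.
    by apply: eq_bigr => j _; rewrite !mxE ti.
  by rewrite big1// => j _; rewrite !mxE ti rmorph0 mulr0.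
have [c vc] : exists c : 'rV_d, v = c *m ratmx (kermx T).
  apply/submxP; rewrite map_kermx; apply/sub_kermxP/rowP => i.
  by rewrite mulT mxE; case: ifP => // /eqP.
pose u (x : 'rV[R]_d) := x *m ratmx (kermx T).
have u_tight x i : tight i -> inner (u x) (ratmx (a i)) = 0.
  move=> ti; have := mulT (u x) i; rewrite ti => <-.
  by rewrite /u -mulmxA -map_mxM mulmx_ker map_mx0 mulmx0 mxE.
have u_inner x i : inner (u x) (ratmx (a i)) = inner (ratmx (a i *m (kermx T)^T)) x.
  rewrite innerC /inner /u; under eq_bigr do rewrite [X in _ * X]mxE mulr_sumr.
  rewrite exchange_big /=; apply: eq_bigr => k _.
  rewrite !mxE rmorph_sum mulr_suml; apply: eq_bigr => j _.
  by rewrite !mxE rmorphM /= mulrCA mulrC mulrA.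
have [e e0 ce] : exists2 e : R, 0 < e & forall x : 'rV[R]_d,
    (forall j, `|c ord0 j - x ord0 j| < e) ->
    forall i, inner (u x) (ratmx (a i)) <= 0.
  have : \forall x \near c, forall i, ~~ tight i -> inner (u x) (ratmx (a i)) < 0.
    suff near i : \forall x \near c, ~~ tight i -> inner (u x) (ratmx (a i)) < 0.
      exact: filter_forall near.
    have [ti|nti] := boolP (tight i); first by apply: (@filterE _ (nbhs c)) => x /negP.
    have : \forall x \near c, inner (ratmx (a i *m (kermx T)^T)) x < 0.
      apply: open_nbhs_nbhs; split; last first.
        by rewrite /= -u_inner /u -vc lt_neqAle nti va.
      apply: (@open_comp _ R (inner _) [set r | r < 0]); last exact: open_lt.
      by move=> y _; exact: inner_continuous.
    by apply: filterS => x; rewrite -u_inner.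
  move=> /nbhs_ballP[e /= e0 ce]; exists e => // x xc i.
  have [ti|nti] := boolP (tight i); first by rewrite u_tight.
  apply/ltW/ce => //; split => // k j; rewrite (ord1 k); exact: xc.
rewrite vc; apply: (@convex_rational_points _ [set x | B (u x)] c e e0).
  apply/is_convexP => x y t t01 /= Bx By.
  by rewrite /u mulmxDl -!scalemxAl; exact: Bco.
move=> q qc /=; rewrite /u -map_mxM; apply: Bq => i.
by rewrite map_mxM; apply: ce => j; rewrite mxE.
Qed.

Lemma common_denominator d (q : 'rV[rat]_d) : exists2 N : nat, (0 < N)%N &
  forall j, exists z : int, N%:R * ratr (q ord0 j) = z%:~R :> R.
Proof.
pose D := \prod_j `|denq (q ord0 j)|%N.
exists D; first by apply: prodn_gt0 => j; rewrite absz_gt0 denq_neq0.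
move=> j; exists ((\prod_(i | i != j) `|denq (q ord0 i)|%N)%:Z * numq (q ord0 j)).
rewrite /D (bigD1 j)//= natrM rmorphM /= mulrAC mulrC; congr (_ * _).
rewrite -{2}[q ord0 j]divq_num_den fmorph_div /= !ratr_int mulrC.
rewrite -[X in _ * X]pmulrn natr_absz gtr0_norm ?denq_gt0// divfK//.
by rewrite intr_eq0 denq_neq0.
Qed.

End RationalCone.

Section PartTwo.
Variables (R : realType) (d : nat).
Implicit Types P M : set 'rV[R]_d.

Lemma closed_convex_rational_polyhedron P : rational_polyhedron P -> closed_convex P.
Proof.
move=> [n [a [alpha [_ ->]]]]; split.
  rewrite (_ : [set x | _] = \bigcap_(i in [set: 'I_n])
      (inner (map_mx ratr (a i)) @^-1` [set r | r <= ratr (alpha i)])); last first.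
    by apply/seteqP; split => x Px i => [_|]; have := Px i; rewrite /= innerC//; apply.
  apply: closed_bigI => i _; apply: preimage_closed; last exact: closed_le.
  by move=> x _; exact: inner_continuous.
apply/is_convexP => x y t /andP[t0 t1] Px Py i.
have := Px i; have := Py i; rewrite innerDl !innerZl.
set p := inner x _; set q := inner y _; set r := ratr _ => qr pr; nra.
Qed.

Lemma rec_cone_polyhedron n (a : 'I_n -> 'rV[R]_d) (alpha : 'I_n -> R) x v :
  let P := [set x | forall i, inner x (a i) <= alpha i] in
  P x -> rec_cone P v -> forall i, inner v (a i) <= 0.
Proof.
move=> P Px Pv i; rewrite leNgt; apply/negP => vi; have xi := Px i.
have := Pv x Px ((alpha i - inner x (a i) + 1) / inner v (a i)).
rewrite divr_ge0 ?(ltW vi)//; last by rewrite addr_ge0// subr_ge0.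
by move=> /(_ isT i); rewrite innerDl innerZl divfK ?gt_eqF//; lra.
Qed.

(** Meyer's argument: an integral recession direction can be followed from a
    mixed-integer point to further mixed-integer points, and rational directions
    have integral multiples. *)
Lemma convex_hull_add_rec M P : mixed_integer_space M -> rational_polyhedron P ->
  minkowski_sum (convex_hull (P `&` M)) (rec_cone P) = convex_hull (P `&` M).
Proof.
move=> [m [n [_ _ ->]]] [k [a [alpha [_ PE]]]]; set Mx := [set x | _].
apply/seteqP; split=> [_ [p pPM [v Pv <-]]|p pPM]; last first.
  by exists p => //; exists 0; rewrite ?addr0// => x Px t _; rewrite scaler0 addr0.
suff PM : P `&` Mx `<=` [set y | convex_hull (P `&` Mx) (y + v)].
  have Hco := convex_translate (v := v) (@convex_convex_hull _ _ (P `&` Mx)).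
  exact: (smallest_sub Hco PM).
move=> x [Px Mx0] /=.
have va : forall i, inner v (map_mx ratr (a i)) <= 0.
  by move: Px Pv; rewrite PE; exact: rec_cone_polyhedron.
pose B := [set y | convex_hull (P `&` Mx) (x + y)].
have Bco : is_convex B.
  rewrite /B (_ : [set y | _] = [set y | convex_hull (P `&` Mx) (y + x)]).
    exact/convex_translate/convex_convex_hull.
  by apply/seteqP; split => y /=; rewrite addrC.
apply: (rational_cone_ind Bco _ va) => q qa; rewrite /B /=.
have [N N0 Nq] := common_denominator R q.
pose y : 'rV[R]_d := x + N%:R *: map_mx ratr q.
have NR : 1 <= N%:R :> R by rewrite ler1n.
have -> : x + map_mx ratr q = N%:R^-1 *: y + (1 - N%:R^-1) *: x.
  by apply/rowP => j; rewrite !mxE; field; rewrite gt_eqF// (lt_le_trans ltr01).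
apply: convex_hull_combination.
- by rewrite invr_ge0 ler0n invf_le1// (lt_le_trans ltr01).
- apply: sub_gen_smallest; split.
    move: Px; rewrite PE => Px i; rewrite innerDl innerZl.
    by rewrite -[leRHS]addr0 lerD// mulr_ge0_le0.
  move=> j jm; rewrite !mxE; have [z ->] := Nq j.
  by apply: rpredD; [exact: Mx0|exact: intr_int].
- exact: sub_gen_smallest.
Qed.

End PartTwo.

Theorem theorem3p6 (R : realType) (d : nat) (d_gt0 : (1 <= d)%N)
    (LL : set (set 'rV[R]_d))
    (LL_neq0 : LL !=set0)
    (LL_convex : forall L, LL L -> closed_convex L /\ has_dim L d)
    (LL_rec : forall L, LL L -> is_linear_space (rec_cone L)) :
  let M := uncovered LL in
  (forall K : set 'rV[R]_d, closed_convex K -> line_free K ->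
     \bigcap_(i in [set: nat]) R_iter LL i K =
       minkowski_sum (convex_hull (K `&` M)) (rec_cone K)) /\
  (mixed_integer_space M ->
   forall P : set 'rV[R]_d, rational_polyhedron P -> line_free P ->
     \bigcap_(i in [set: nat]) R_iter LL i P = convex_hull (P `&` M)).
Proof.
move=> M.
have LLcc L : LL L -> closed_convex L by move=> /LL_convex[].
split=> [K Kcc Klf|Mint P Prat Plf]; first exact: bigcap_R_iter.
rewrite bigcap_R_iter//; first exact: convex_hull_add_rec.
exact: closed_convex_rational_polyhedron.
Qed.
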